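(* We have $$\lim_{x\to\infty}\ \sup_{\substack{A\subset[x,\infty)\\ A\text{ primitive}}} f(A)\ \le\ e^{\gamma}\frac{\pi}{4},$$ where $\gamma$ is the Euler–Mascheroni constant and $f(A)=\sum_{a\in A}\frac{1}{a\log a}$.
   Context: A set $A\subset\mathbb{Z}_{>1}$ is primitive if no member of $A$ divides another member of $A$. The supremum is over primitive sets of integers all of whose elements are at least $x$. *)

(* Defs.v *)
From HB Require Import structures.
From mathcomp Require Import all_boot all_order all_algebra.
From mathcomp Require Import all_classical all_reals all_analysis.
Set Implicit Arguments. Unset Strict Implicit. Unset Printing Implicit Defensive.
Import Order.TTheory GRing.Theory Num.Theory.
Import numFieldNormedType.Exports.
Local Open Scope classical_set_scope.
Local Open Scope ring_scope.

Definition euler_gamma (R : realType) : R :=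
  lim ((fun n : nat => \sum_(0 <= k < n) (k.+1%:R)^-1 - ln (n%:R : R)) @ \oo).

Definition primitive (A : set nat) : Prop :=
  (forall a, A a -> (1 < a)%N) /\
  (forall a b, A a -> A b -> (a %| b)%N -> a = b).

Definition fsum (R : realType) (A : set nat) : \bar R :=
  (\esum_(a in A) (((a%:R : R) * ln (a%:R : R))^-1)%:E)%E.

Definition primsup (R : realType) (x : R) : \bar R :=
  ereal_sup [set fsum R A | A in [set A | primitive A /\ (forall a, A a -> x <= a%:R)]].

(* Main.v *)
(** In fact [f(A) <= 1 + O(1 / ln x)] for primitive [A] in [[x, +oo[], and [1 < e^gamma pi / 4].
    Since [sum_(q | m) Lambda(q) = ln m], moving from [m] to [m / q] with probability [Lambda(q) / ln m] is a Markov chain going down the divisibility order. By Mertens' estimate [sum_(q <= y) Lambda(q) / q = ln y + O(1)], the weight [1 / (m ln m)] is superinvariant for it after a small correction [nu]. Start mass [nu a] at every [a] in [A] and let it run down until it falls below [x]. A trajectory meets a primitive set only once, so the mass flowing through [m] never exceeds [nu m]; hence the total mass, which dominates [f(A)], is at most the flux of [nu] across the level [x], namely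
    [sum_(n < x) 1/n sum_(q >= x/n) Lambda(q) / (q ln(nq)^2) = 1 + O(1 / ln x)]. *)
Require Import Defs.
From HB Require Import structures.
From mathcomp Require Import all_boot all_order all_algebra.
From mathcomp Require Import all_classical all_reals all_analysis.
From mathcomp Require Import ring lra.
Set Implicit Arguments. Unset Strict Implicit. Unset Printing Implicit Defensive.
Import Order.TTheory GRing.Theory Num.Theory.
Import numFieldNormedType.Exports.
Local Open Scope classical_set_scope.
Local Open Scope ring_scope.

(** * Flows along a divisor chain *)

Section Flow.
Variables (R : realFieldType) (N X : nat) (A : pred nat).
Variables (nu : nat -> R) (p : nat -> nat -> R).
Hypothesis X_gt0 : (0 < X)%N.
Hypothesis A_range : forall a, A a -> (X <= a <= N)%N.
Hypothesis A_primitive : forall a b, A a -> A b -> (a %| b)%N -> a = b.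
Hypothesis nu_ge0 : forall m, (X <= m)%N -> 0 <= nu m.
Hypothesis p_ge0 : forall m q, (X <= m)%N -> 0 <= p m q.
Hypothesis p_total : forall m, (X <= m <= N)%N ->
  \sum_(2 <= q < N.+1) \sum_(1 <= n < N.+1 | (n * q == m)%N) p m q = 1.
Hypothesis nu_super : forall n, (X <= n)%N ->
  \sum_(2 <= q < N.+1) nu (n * q)%N * p (n * q)%N q <= nu n.

(** Mass passing through [m] on trajectories that reach it in fewer than [k] jumps. The recursion
    climbs to multiples of [m], hence the fuel [k]. *)
Fixpoint flow_iter (k m : nat) : R :=
  if k is k'.+1 then
    nu m * (A m)%:R +
    \sum_(2 <= q < N.+1) flow_iter k' (m * q)%N * p (m * q)%N q
  else 0.

Lemma leq_mul_nat m q : (1 < q)%N -> (m <= m * q)%N.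
Proof. by move=> q1; rewrite leq_pmulr// ltnW. Qed.

(** Mass only moves down to divisors, so [m] is fed only by members of [A] that are multiples of
    it. *)
Lemma flow_iter_eq0 k m : (0 < m)%N ->
  (forall a, A a -> ~~ (m %| a)%N) -> flow_iter k m = 0.
Proof.
elim: k m => //= k IH m m0 mA.
have -> : A m = false by apply/negP => /mA; rewrite dvdnn.
rewrite mulr0 add0r big_nat big1// => q /andP[q1 _].
rewrite IH ?mul0r ?muln_gt0 ?m0//=; first by rewrite ltnW.
move=> a /mA; apply: contra => /(dvdn_trans _); apply; exact: dvdn_mulr.
Qed.

Lemma flow_iter_multiple k a q : A a -> (1 < q)%N -> flow_iter k (a * q)%N = 0.
Proof.
move=> Aa q1; have /andP[Xa _] := A_range Aa.
have a0 : (0 < a)%N by apply: leq_trans Xa.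
apply: flow_iter_eq0 => [|b Ab].
  by rewrite muln_gt0 a0 ltnW.
apply/negP => aqb; have ab : (a %| b)%N by apply: dvdn_trans aqb; exact: dvdn_mulr.
move: aqb; rewrite -(A_primitive Aa Ab ab) => /dvdn_leq; rewrite a0 => /(_ isT).
by rewrite leqNgt ltn_Pmulr.
Qed.

(** At a member of [A], primitivity lets nothing arrive from proper multiples, so only the source
    [nu m] remains; elsewhere superinvariance propagates the bound. *)
Lemma flow_iter_bound k m : (X <= m)%N -> 0 <= flow_iter k m <= nu m.
Proof.
elim: k m => [|k IH] m Xm /=; first by rewrite lexx nu_ge0.
have Xmq q : (1 < q)%N -> (X <= m * q)%N.
  by move=> q1; apply: leq_trans Xm _; exact: leq_mul_nat.
apply/andP; split.
  rewrite addr_ge0 ?mulr_ge0 ?nu_ge0// big_nat sumr_ge0// => q /andP[q1 _].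
  by rewrite mulr_ge0 ?p_ge0 ?Xmq//; have /andP[] := IH _ (Xmq _ q1).
case: (boolP (A m)) => Am.
  rewrite mulr1 big_nat big1 ?addr0// => q /andP[q1 _].
  by rewrite flow_iter_multiple ?mul0r.
rewrite mulr0 add0r; apply: le_trans (nu_super Xm).
rewrite !big_nat; apply: ler_sum => q /andP[q1 _].
rewrite ler_wpM2r ?p_ge0 ?Xmq//; by have /andP[] := IH _ (Xmq _ q1).
Qed.

Lemma flow_iter_out k m : (N < m)%N -> flow_iter k m = 0.
Proof.
move=> Nm; apply: flow_iter_eq0 => [|a Aa]; first exact: leq_ltn_trans Nm.
have /andP[Xa aN] := A_range Aa.
apply/negP => /dvdn_leq; rewrite (leq_trans X_gt0 Xa) => /(_ isT) ma.
by move: (leq_trans Nm (leq_trans ma aN)); rewrite ltnn.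
Qed.

(** Each level of the recursion at least doubles the argument; after [k] levels it exceeds [N],
    where the flow vanishes. *)
Lemma flow_iter_stable k m : (N < m * 2 ^ k)%N ->
  flow_iter k.+1 m = flow_iter k m.
Proof.
elim: k m => [|k IH] m Nm.
  by rewrite flow_iter_out//; rewrite expn0 muln1 in Nm.
rewrite [LHS]/= [RHS]/=; congr (_ + _); rewrite !big_nat.
apply: eq_bigr => q /andP[q1 _]; rewrite -IH//.
apply: leq_trans Nm _; rewrite expnS mulnA leq_mul2r leq_mul2l q1.
by rewrite !orbT.
Qed.

(** [N] rounds suffice for every positive [m], since [N < 2 ^ N]. *)
Let D := flow_iter N.

Lemma flow_fixpoint m : (0 < m)%N ->
  D m = nu m * (A m)%:R + \sum_(2 <= q < N.+1) D (m * q)%N * p (m * q)%N q.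
Proof.
move=> m0; rewrite {1}/D -flow_iter_stable//.
by apply: leq_trans (leq_mul m0 (ltn_expl N (ltnSn 1))); rewrite mul1n.
Qed.

(* The mass [nu a] started at each [a] of [A] runs down the chain [m -> m / q]; all of it crosses below [X], and primitivity keeps the flow through [m] below [nu m]. *)
Lemma primitive_flow_bound :
  \sum_(X <= m < N.+1 | A m) nu m <=
  \sum_(1 <= n < X) \sum_(2 <= q < N.+1 | (X <= n * q)%N)
    nu (n * q)%N * p (n * q)%N q.
Proof.
(* [F n] is the mass landing on [n] from levels at or above [X]. *)
pose F n := \sum_(2 <= q < N.+1 | (X <= n * q)%N) D (n * q)%N * p (n * q)%N q.
(* The probabilities out of [m] sum to 1, so all its flow leaves; regroup it by the landing point
   [n = m / q]. *)
have total : \sum_(X <= m < N.+1) D m = \sum_(1 <= n < N.+1) F n.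
  transitivity (\sum_(X <= m < N.+1) \sum_(2 <= q < N.+1)
      \sum_(1 <= n < N.+1) if (n * q == m)%N then D m * p m q else 0).
    rewrite !big_nat; apply: eq_bigr => m mXN.
    rewrite -{1}(mulr1 (D m)) -(p_total mXN) mulr_sumr; apply: eq_bigr => q _.
    by rewrite mulr_sumr big_mkcond.
  rewrite exchange_big /= /F.
  under [RHS]eq_bigr => n _ do rewrite big_mkcond.
  rewrite [RHS]exchange_big /=; rewrite !big_nat; apply: eq_bigr => q /andP[q1 _].
  rewrite exchange_big /=; rewrite !big_nat; apply: eq_bigr => n /andP[n0 _].
  case: ifPn => [Xnq|]; last first.
    rewrite -ltnNge => nqX; rewrite big_nat big1// => m /andP[Xm _].
    by case: eqP => // nqm; move: (leq_trans nqX Xm); rewrite nqm ltnn.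
  have [nqN|Nnq] := leqP (n * q)%N N; last first.
    rewrite {2}/D flow_iter_out// mul0r big_nat big1// => m /andP[Xm mN].
    by case: eqP => // nqm; move: (leq_trans mN Nnq); rewrite nqm ltnn.
  rewrite (big_cat_nat Xnq) ?(leqW nqN)//= (big_ltn (m := (n * q)%N))//= eqxx.
  rewrite [X in X + _]big_nat [X in X + _]big1 ?add0r => [|m /andP[_]].
    rewrite [X in _ + X]big_nat [X in _ + X]big1 ?addr0// => m /andP[+ _].
    by case: eqP => // ->; rewrite ltnn.
  by case: eqP => // ->; rewrite ltnn.
have [XN|NX] := leqP X N.+1; last first.
  rewrite big_geq ?(ltnW NX)// big_nat sumr_ge0// => n _.
  rewrite big_nat_cond sumr_ge0// => q /andP[_ Xq].
  by rewrite mulr_ge0 ?nu_ge0 ?p_ge0.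
have inner : \sum_(X <= m < N.+1) D m =
    \sum_(X <= m < N.+1 | A m) nu m + \sum_(X <= n < N.+1) F n.
  rewrite [X in X + _]big_mkcond -big_split /= !big_nat.
  apply: eq_bigr => m /andP[Xm _].
  rewrite flow_fixpoint ?(leq_trans X_gt0)//; congr (_ + _).
    by case: (A m); rewrite ?mulr1 ?mulr0.
  rewrite /F [LHS]big_nat_cond [RHS]big_nat_cond; apply: congr_big => // q.
  case/boolP: (1 < q)%N => //= q1; case: (q < N.+1)%N => //=.
  by rewrite (leq_trans Xm)// leq_mul_nat.
(* Flow landing in [[X, N]] occurs in both counts and cancels, leaving the flux across [X]. *)
have -> : \sum_(X <= m < N.+1 | A m) nu m = \sum_(1 <= n < X) F n.
  apply: (@addIr _ (\sum_(X <= n < N.+1) F n)).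
  by rewrite -inner total -big_cat_nat.
rewrite ![\sum_(1 <= _ < X) _]big_nat; apply: ler_sum => n _.
rewrite /F; apply: ler_sum => q Xnq.
by rewrite ler_wpM2r ?p_ge0//; have /andP[] := flow_iter_bound N Xnq.
Qed.

End Flow.

(** * Chebyshev and Mertens bounds *)

Section VonMangoldt.
Variable R : realType.

Local Notation L n := (ln (n%:R : R)).

Definition von_mangoldt (n : nat) : R :=
  if size (primes n) == 1%N then L (pdiv n) else 0.

Local Notation Lambda := von_mangoldt.

Lemma ln_nat_ge0 (n : nat) : 0 <= L n.
Proof. by case: n => [|n]; [rewrite ln0|rewrite ln_ge0// ler1n]. Qed.

Lemma lnM_nat (m n : nat) : (0 < m)%N -> (0 < n)%N -> L (m * n) = L m + L n.
Proof. by move=> m0 n0; rewrite natrM lnM// posrE ltr0n. Qed.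

Lemma le_ln_nat (m n : nat) : (0 < m)%N -> (m <= n)%N -> L m <= L n.
Proof.
move=> m0 mn; rewrite ler_ln ?posrE ?ltr0n ?ler_nat//; exact: leq_trans mn.
Qed.

Lemma von_mangoldt_ge0 n : 0 <= Lambda n.
Proof. by rewrite /von_mangoldt; case: ifP => // _; exact: ln_nat_ge0. Qed.

Lemma von_mangoldt1 : Lambda 1 = 0.
Proof. by []. Qed.

Lemma von_mangoldt_pfactor p k : prime p -> Lambda (p ^ k.+1) = L p.
Proof.
by move=> pp; rewrite /von_mangoldt primesX// primes_prime// pdiv_pfactor.
Qed.

Lemma von_mangoldt_neq0 n : Lambda n != 0 ->
  exists p k, prime p /\ n = (p ^ k.+1)%N.
Proof.
rewrite /von_mangoldt; case: ifP => [sn _|_ /eqP//].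
have [p pn] : exists p, primes n = [:: p].
  by case: (primes n) sn => [|p []]// _; exists p.
have n0 : (0 < n)%N by case: n pn {sn}.
have : p \in primes n by rewrite pn mem_seq1.
rewrite mem_primes => /and3P[pp _ pdn].
exists p, (logn p n).-1; split => //.
have lp : (0 < logn p n)%N by rewrite logn_gt0 pn mem_seq1.
rewrite prednK//; have := prod_prime_decomp n0.
by rewrite prime_decompE pn /= big_seq1 => {1}->.
Qed.

(* Among prime powers, only [p ^ (v_p m + 1)] divides [p m] but not [m]. *)
Lemma von_mangoldt_dvd_step p m d : prime p -> (0 < m)%N ->
  (d %| p * m)%N%:R * Lambda d =
  (d %| m)%N%:R * Lambda d + (d == p ^ (logn p m).+1)%N%:R * L p :> R.
Proof.
move=> pp m0; have pm0 : (0 < p * m)%N by rewrite muln_gt0 prime_gt0.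
have [Ld|/von_mangoldt_neq0[r [k [pr ->]]]] := eqVneq (Lambda d) 0.
  rewrite Ld !mulr0 add0r; case: eqP => [dp|_]; last by rewrite mul0r.
  by move: Ld; rewrite dp von_mangoldt_pfactor// => ->; rewrite mulr0.
rewrite von_mangoldt_pfactor// !pfactor_dvdn// lognM ?(prime_gt0 pp)//.
rewrite (logn_prime _ pp).
have [->{r pr}|rp] := eqVneq r p.
  rewrite add1n eqn_exp2l ?prime_gt1// eqSS ltnS [(k <= _)%N]leq_eqVlt.
  case: eqP => [->|_] /=; first by rewrite ltnn mul0r add0r.
  by rewrite mul0r addr0.
rewrite add0n.
suff -> : (r ^ k.+1 == p ^ (logn p m).+1)%N = false by rewrite mul0r addr0.
apply/negP => /eqP e; have : (r %| p ^ (logn p m).+1)%N.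
  by rewrite -e expnS dvdn_mulr.
by rewrite Euclid_dvdX// dvdn_prime2// andbT (negbTE rp).
Qed.

(** Strip a prime [p] off [n = p * m]: exactly one new prime power enters, adding [L p]. With [N]
    free, one range of [d] serves both [n] and [m], and later interchanges of sums. *)
Lemma sum_von_mangoldt_dvd N n : (0 < n <= N)%N ->
  \sum_(1 <= d < N.+1) (d %| n)%N%:R * Lambda d = L n.
Proof.
elim/ltn_ind: n => n IH /andP[n0 nN].
have [n1|n1] := leqP n 1.
  have -> : n = 1%N by case: n n0 n1 {IH nN} => [|[]].
  rewrite ln1 big_nat big1// => d /andP[d0 _]; rewrite dvdn1.
  by case: eqP => [->|_]; rewrite ?mul0r// von_mangoldt1 mulr0.
have [p pp /dvdnP[m]] : exists2 p, prime p & (p %| n)%N.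
  by exists (pdiv n); rewrite ?pdiv_prime ?pdiv_dvd.
rewrite mulnC => nm.
have m0 : (0 < m)%N by case: m nm n0 => [->|]//; rewrite muln0.
have mn : (m < n)%N by rewrite nm ltn_Pmull// prime_gt1.
have pN : (p ^ (logn p m).+1 <= N)%N.
  apply: leq_trans nN; rewrite dvdn_leq// pfactor_dvdn// nm lognM ?(prime_gt0 pp)//.
  by rewrite (logn_prime _ pp) eqxx.
rewrite nm lnM_nat ?(prime_gt0 pp)//.
rewrite -(IH _ mn) ?m0 ?(leq_trans (ltnW mn))// addrC.
under eq_bigr => d _ do rewrite (von_mangoldt_dvd_step _ pp m0).
rewrite big_split /=; congr (_ + _).
rewrite (bigD1_seq (p ^ (logn p m).+1)%N) ?iota_uniq//=; last first.
  by rewrite mem_index_iota expn_gt0 prime_gt0//= ltnS.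
by rewrite eqxx mul1r big1 ?addr0// => d /negbTE ->; rewrite mul0r.
Qed.

(** Legendre's formula: expand each [L m] over its divisors and count the [n %/ d] multiples of
    [d]. *)
Lemma ln_fact_von_mangoldt N n : (n <= N)%N ->
  L n`! = \sum_(1 <= d < N.+1) Lambda d * (n %/ d)%:R.
Proof.
move=> nN; have -> : L n`! = \sum_(1 <= m < n.+1) L m.
  elim: n {nN} => [|n IH]; first by rewrite fact0 ln1 big_geq.
  by rewrite factS lnM_nat ?fact_gt0// big_nat_recr//= -IH addrC.
rewrite big_nat; under eq_bigr => m /andP[m0 mn].
  rewrite -(@sum_von_mangoldt_dvd N) ?m0//=; last exact: leq_trans nN.
  over.
rewrite -big_nat exchange_big /=; apply: eq_bigr => d _.
by rewrite -mulr_suml mulrC -natr_sum divn_count_dvd.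
Qed.

Definition chebyshev_psi (n : nat) : R := \sum_(1 <= d < n.+1) Lambda d.
Definition mertens_sum (n : nat) : R := \sum_(1 <= d < n.+1) Lambda d / d%:R.

Lemma chebyshev_psi_homo m n : (m <= n)%N -> chebyshev_psi m <= chebyshev_psi n.
Proof.
move=> mn; rewrite /chebyshev_psi (@big_cat_nat _ _ _ m.+1 1 n.+1)//= lerDl.
by apply: sumr_ge0 => d _; exact: von_mangoldt_ge0.
Qed.

(** In the logarithm of the central binomial, [Lambda d] has weight [2n %/ d - 2 (n %/ d)], which is
    nonnegative, and at least 1 for [n < d <= 2n]. *)
Lemma chebyshev_psi_double n :
  chebyshev_psi (2 * n) - chebyshev_psi n <= (2 * n)%:R * ln 2.
Proof.
have nn : (n <= 2 * n)%N by rewrite leq_pmull.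
have bin_le : ('C(2 * n, n) <= 2 ^ (2 * n))%N.
  have -> : (2 ^ (2 * n) = (1 + 1) ^ (2 * n))%N by [].
  rewrite Pascal (bigD1 (inord n : 'I_(2 * n).+1)) //=.
  by rewrite inordK ?ltnS// !exp1n !muln1 leq_addr.
have binL : L 'C(2 * n, n) = L (2 * n)`! - L n`! *+ 2.
  rewrite -(bin_fact nn) lnM_nat ?bin_gt0 ?muln_gt0 ?fact_gt0//.
  have -> : (2 * n - n = n)%N by rewrite mul2n -addnn addnK.
  by rewrite lnM_nat ?fact_gt0// mulr2n addrK.
have -> : (2 * n)%:R * ln 2 = L (2 ^ (2 * n)) :> R.
  by rewrite natrX lnXn// mulr_natl.
apply: le_trans (le_ln_nat _ bin_le); last by rewrite bin_gt0.
rewrite binL (ln_fact_von_mangoldt (leqnn _)) (ln_fact_von_mangoldt nn).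
rewrite -sumrMnl -sumrB /chebyshev_psi (@big_cat_nat _ _ _ n.+1 1 (2 * n).+1)//=.
rewrite addrAC subrr add0r (@big_cat_nat _ _ _ n.+1 1 (2 * n).+1)//= ler_wpDl//.
  rewrite big_nat sumr_ge0// => d /andP[d0 _].
  rewrite -mulrnAr -mulrBr mulr_ge0 ?von_mangoldt_ge0//.
  rewrite -mulrnA subr_ge0 ler_nat leq_divRL//.
  by rewrite mulnAC mulnC leq_mul2l leq_trunc_div.
rewrite !big_nat; apply: ler_sum => d /andP[nd d2n].
rewrite (divn_small nd) mulr0 mul0rn subr0 ler_peMr ?von_mangoldt_ge0//.
by rewrite ler1n divn_gt0// (leq_ltn_trans _ nd).
Qed.

Lemma ln2_le1 : ln 2 <= 1 :> R.
Proof. by have := @le_ln1Dx R 1; rewrite -(natrD _ 1 1) => -> //; lra. Qed.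

(** Doubling with [ln 2 <= 1] gives the constant 2 at powers of two; the next power of two above [n]
    is at most [2n], which costs another factor 2. *)
Lemma chebyshev_psi_le n : chebyshev_psi n <= 4 * n%:R.
Proof.
have pow k : chebyshev_psi (2 ^ k) <= 2 * (2 ^ k)%:R.
  elim: k => [|k IH].
    by rewrite /chebyshev_psi expn0 big_nat1 von_mangoldt1; lra.
  have := chebyshev_psi_double (2 ^ k); rewrite -expnS => H.
  have : (2 ^ k.+1)%:R * ln 2 <= (2 ^ k.+1)%:R :> R.
    by rewrite ler_piMr ?ler0n ?ln2_le1.
  have : (2 ^ k.+1)%:R = 2 * (2 ^ k)%:R :> R by rewrite expnS natrM.
  lra.
case: n => [|n]; first by rewrite /chebyshev_psi big_geq// mulr0.
have /andP[ln1 n1l] : (2 ^ trunc_log 2 n.+1 <= n.+1 < 2 ^ (trunc_log 2 n.+1).+1)%N.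
  exact: trunc_log_bounds.
apply: le_trans (chebyshev_psi_homo (ltnW n1l)) _; apply: le_trans (pow _) _.
rewrite expnS natrM mulrA; have : (2 ^ trunc_log 2 n.+1)%:R <= n.+1%:R :> R.
  by rewrite ler_nat.
lra.
Qed.

Lemma ln_succ_sub_le n : (0 < n)%N -> L n.+1 - L n <= n%:R^-1.
Proof.
move=> n0; rewrite -ln_div ?posrE ?ltr0n//.
have -> : n.+1%:R / n%:R = 1 + n%:R^-1 :> R.
  by rewrite -natr1 mulrDl divff ?pnatr_eq0 -?lt0n// mul1r.
by apply: le_ln1Dx; apply: lt_le_trans (_ : 0 <= _); rewrite ?ltrN10 ?invr_ge0.
Qed.

Lemma ln_succ_sub_ge n : (0 < n)%N -> n.+1%:R^-1 <= L n.+1 - L n.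
Proof.
move=> n0; rewrite -[leRHS]opprK opprB -ln_div ?posrE ?ltr0n//.
have -> : n%:R / n.+1%:R = 1 - n.+1%:R^-1 :> R.
  have n1 : n.+1%:R != 0 :> R by rewrite pnatr_eq0.
  by apply: (mulIf n1); rewrite divfK// mulrBl mul1r mulVf// -natr1 addrK.
rewrite lerNr; apply: le_ln1Dx.
by rewrite ltrN2 invf_lt1 ?ltr0n// ltr1n ltnS.
Qed.

Lemma ln_fact_ge n : n%:R * L n - n%:R <= L n`!.
Proof.
elim: n => [|n IH]; first by rewrite fact0 ln1 !mul0r subr0.
rewrite factS lnM_nat ?fact_gt0//.
suff : n%:R * (L n.+1 - L n) <= 1.
  move: IH; set a := L n.+1; set b := L n; set c := L n`!.
  by rewrite -natr1; lra.
case: n {IH} => [|n]; first by rewrite mul0r.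
by rewrite mulrC -ler_pdivlMr ?ltr0n// mul1r ln_succ_sub_le.
Qed.

Lemma ln_fact_le n : L n`! <= n%:R * L n.
Proof.
case: n => [|n]; first by rewrite fact0 ln1 mul0r.
rewrite mulr_natl -lnXn ?ltr0n// -natrX le_ln_nat ?fact_gt0//.
elim: n => // n IH; rewrite factS expnS leq_mul2l (leq_trans IH)//.
by rewrite leq_exp2r.
Qed.

Lemma mertens_sum_ge n : (0 < n)%N -> L n - 1 <= mertens_sum n.
Proof.
move=> n0; rewrite -(ler_pM2l (_ : 0 < n%:R)) ?ltr0n// mulrBr mulr1.
apply: le_trans (ln_fact_ge n) _; rewrite (ln_fact_von_mangoldt (leqnn n)).
rewrite /mertens_sum mulr_sumr !big_nat; apply: ler_sum => d /andP[d0 _].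
rewrite mulrCA ler_wpM2l ?von_mangoldt_ge0// ler_pdivlMr ?ltr0n//.
by rewrite -natrM ler_nat leq_trunc_div.
Qed.

(** Replacing [n / d] by its floor loses at most [Lambda d] per term, in total at most
    [chebyshev_psi n <= 4n]; the rest is [ln n!]. *)
Lemma mertens_sum_le n : (0 < n)%N -> mertens_sum n <= L n + 4.
Proof.
move=> n0; rewrite -(ler_pM2l (_ : 0 < n%:R)) ?ltr0n// mulrDr.
apply: le_trans (lerD (ln_fact_le n) (_ : chebyshev_psi n <= _)); last first.
  by rewrite mulrC chebyshev_psi_le.
rewrite (ln_fact_von_mangoldt (leqnn n)).
rewrite /mertens_sum mulr_sumr -big_split /= !big_nat; apply: ler_sum => d /andP[d0 _].
rewrite mulrCA -[X in _ + X]mulr1 -mulrDr ler_wpM2l ?von_mangoldt_ge0//.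
rewrite ler_pdivrMr ?ltr0n// natr1 -natrM ler_nat.
by rewrite ltnW// ltn_ceil.
Qed.

End VonMangoldt.

(** * Sums over primitive sets *)

Section PrimitiveSums.
Variable R : realType.
Local Notation L n := (ln (n%:R : R)).
Local Notation Lambda := (@von_mangoldt R).

(* Partial summation against Mertens' estimate [-1 <= M(q) - ln q <= 4]. *)
Lemma von_mangoldt_tail n Q K : (0 < n)%N -> (0 < Q <= K)%N ->
  5 < L (n * Q) ->
  \sum_(Q.+1 <= q < K.+1) Lambda q / q%:R / (L (n * q) - 5) ^+ 2 <=
  (L (n * Q) - 5)^-1 + 5 / (L (n * Q) - 5) ^+ 2.
Proof.
move=> n0 /andP[Q0 QK] LQ.
pose u q := L (n * q) - 5; rewrite -!/(u _).
have u_gt0 q : (Q <= q)%N -> 0 < u q.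
  move=> Qq; rewrite /u subr_gt0 (lt_le_trans LQ)// le_ln_nat ?muln_gt0 ?n0//.
  by rewrite leq_mul2l Qq orbT.
(* Induction on [K] needs the boundary term of the partial summation; the upper Mertens bound makes
   it nonpositive, so it is dropped. The lower bound serves the base case [K = Q]. *)
suff H : \sum_(Q.+1 <= q < K.+1) Lambda q / q%:R / u q ^+ 2 <=
    (u Q)^-1 - (u K)^-1 + 5 / u Q ^+ 2 + (mertens_sum R K - L K - 4) / u K ^+ 2.
  apply: le_trans H _.
  have := u_gt0 _ QK; rewrite -invr_gt0 => uK.
  have K0 : (0 < K)%N by apply: leq_trans QK.
  suff : 0 <= (4 - (mertens_sum R K - L K)) / u K ^+ 2 by lra.
  rewrite mulr_ge0 ?invr_ge0 ?sqr_ge0// subr_ge0 lerBlDl.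
  exact: mertens_sum_le.
elim: K QK => [|K IH]; first by rewrite leqNgt Q0.
rewrite leq_eqVlt => /orP[/eqP <-|].
  rewrite big_geq// subrr add0r -mulrDl mulr_ge0 ?invr_ge0 ?sqr_ge0//.
  by have := mertens_sum_ge R Q0; lra.
rewrite ltnS => QK; rewrite big_nat_recr//=.
have K0 : (0 < K)%N by apply: leq_trans QK.
apply: le_trans (lerD (IH QK) (lexx _)) _.
have uK := u_gt0 _ QK; have uK1 := u_gt0 _ (leqW QK).
have -> : Lambda K.+1 / K.+1%:R = mertens_sum R K.+1 - mertens_sum R K.
  by rewrite /mertens_sum big_nat_recr//= addrAC subrr add0r.
have /= MK := mertens_sum_le R K0.
have d0 : L K <= L K.+1 by apply: le_ln_nat.
have uE : u K.+1 = u K + (L K.+1 - L K).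
  by rewrite /u !lnM_nat//; lra.
set m := mertens_sum R K in MK *; set m' := mertens_sum R K.+1.
have h1 : (L K.+1 - L K) / u K.+1 ^+ 2 <= (u K)^-1 - (u K.+1)^-1.
  have -> : (u K)^-1 - (u K.+1)^-1 = (L K.+1 - L K) / (u K * u K.+1).
    by rewrite uE in uK1 *; field; rewrite !gt_eqF.
  rewrite ler_wpM2l ?subr_ge0// lef_pV2 ?posrE ?mulr_gt0 ?exprn_gt0//.
  by rewrite expr2 ler_wpM2r ?(ltW uK1)// uE; move: d0; lra.
have h2 : (4 + L K - m) / u K.+1 ^+ 2 <= (4 + L K - m) / u K ^+ 2.
  rewrite ler_wpM2l ?subr_ge0//; first by lra.
  rewrite lef_pV2 ?posrE ?exprn_gt0// ler_pXn2r ?nnegrE ?(ltW uK) ?(ltW uK1)//.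
  by rewrite uE; move: d0; lra.
by move: h1 h2; set a := (u K.+1 ^+ 2)^-1; set b := (u K ^+ 2)^-1; lra.
Qed.

Lemma sum_inv_le_ln n : (0 < n)%N -> \sum_(1 <= k < n.+1) k%:R^-1 <= 1 + L n.
Proof.
elim: n => // -[_ _|n IH _]; first by rewrite big_nat1 ln1 addr0 invr1.
rewrite big_nat_recr//=; move: (IH isT) (@ln_succ_sub_ge R n.+1 isT).
by set a := n.+2%:R^-1; set b := ln n.+2%:R; lra.
Qed.

(** The inner sum has one term if [q] divides [m] and none otherwise, so this is the divisor sum of
    [Lambda] divided by [L m]; [q = 1] has weight 0. *)
Lemma von_mangoldt_transition_total N m : (1 < m <= N)%N ->
  \sum_(2 <= q < N.+1) \sum_(1 <= n < N.+1 | (n * q == m)%N)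
    Lambda q / L m = 1.
Proof.
move=> /andP[m1 mN]; have m0 := ltnW m1.
have Lm : L m != 0 by rewrite gt_eqF// ln_gt0// ltr1n.
have N0 : (0 < N)%N by apply: leq_trans mN.
apply: (mulIf Lm); rewrite mul1r -[RHS](@sum_von_mangoldt_dvd R N) ?m0//.
rewrite [RHS]big_ltn// von_mangoldt1 mulr0 add0r mulr_suml !big_nat.
apply: eq_bigr => q /andP[q1 qN]; have q0 := ltnW q1.
have [/dvdnP[k mk]|qm] := boolP (q %| m)%N; last first.
  rewrite big1 ?mul0r// => n /eqP nq; move: qm; rewrite -nq dvdn_mull//.
rewrite (eq_bigl (fun n => n == k)); last first.
  by move=> n; rewrite mk eqn_pmul2r.
rewrite big_nat1_eq; have -> : (0 < k < N.+1)%N.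
  have k0 : (0 < k)%N by case: k mk m0 => // ->.
  by rewrite k0 ltnS (leq_trans _ mN)// mk leq_pmulr.
by rewrite mul1r divfK.
Qed.

Lemma primitive_finite_bound (X N : nat) (A : pred nat) :
  7 <= L X ->
  (forall a, A a -> (X <= a <= N)%N) ->
  (forall a b, A a -> A b -> (a %| b)%N -> a = b) ->
  \sum_(X <= m < N.+1 | A m) (m%:R * L m)^-1 <= 1 + 47 / (L X - 6).
Proof.
move=> LX7 A_range A_prim.
have X1 : (1 < X)%N.
  rewrite ltnNge; apply/negP => X1.
  by have := @ln_le0 R X%:R; rewrite lern1 X1 => /(_ isT); lra.
have X0 := ltnW X1.
have LX m : (X <= m)%N -> 7 <= L m.
  by move=> Xm; apply: le_trans LX7 _; exact: le_ln_nat.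
(* The shift by 5 solves [1/(l - 5) + 5/(l - 5)^2 = l/(l - 5)^2] at [l = ln m]: the tail bound then makes [nu], which dominates [1/(m ln m)], exactly superinvariant. *)
pose nu m := L m / (m%:R * (L m - 5) ^+ 2).
pose p m q := Lambda q / L m.
have nupE n q : (0 < n)%N -> (0 < q)%N -> (X <= n * q)%N ->
    nu (n * q)%N * p (n * q)%N q =
    n%:R^-1 * (Lambda q / q%:R / (L (n * q) - 5) ^+ 2).
  move=> n0 q0 /LX Lnq; rewrite /nu /p.
  set l := L (n * q) in Lnq *; rewrite natrM.
  have [l0 l5] : l != 0 /\ l - 5 != 0 by split; apply: lt0r_neq0; lra.
  by field; rewrite l0 l5 !pnatr_eq0 -!lt0n n0 q0.
have nu_super n : (X <= n)%N ->
    \sum_(2 <= q < N.+1) nu (n * q)%N * p (n * q)%N q <= nu n.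
  move=> Xn; have n0 : (0 < n)%N by apply: leq_trans Xn.
  have Ln := LX _ Xn.
  have [N0|N0] := posnP N.
    by rewrite N0 big_geq// divr_ge0 ?mulr_ge0 ?sqr_ge0 ?ler0n//; lra.
  rewrite big_nat; under eq_bigr => q /andP[q1 _].
    rewrite nupE ?(ltnW q1)//; last by rewrite (leq_trans Xn)// leq_mul_nat.
    over.
  rewrite -big_nat -mulr_sumr.
  (* With [Q = 1] the tail covers every [q >= 2]. *)
  have := @von_mangoldt_tail n 1 N n0 N0; rewrite muln1 => tail.
  have {}tail : _ <= _ := tail ltac:(lra).
  apply: le_trans (ler_wpM2l _ tail) _; first by rewrite invr_ge0.
  rewrite le_eqVlt; apply/orP; left; apply/eqP; rewrite /nu; field.
  by rewrite pnatr_eq0 -lt0n n0 andbT; apply: lt0r_neq0; lra.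
have flow := @primitive_flow_bound R N X A nu p X0 A_range A_prim.
apply: le_trans (le_trans _ (flow _ _ _ nu_super)) _.
- rewrite big_nat_cond [leRHS]big_nat_cond; apply: ler_sum => m /andP[/andP[Xm _] _].
  have Lm := LX _ Xm; have m0 : (0 < m%:R :> R) by rewrite ltr0n (leq_trans X0).
  have L0 : 0 < L m by lra.
  rewrite /nu ler_pdivlMr; last by rewrite mulr_gt0// exprn_gt0//; lra.
  rewrite invfM mulrACA mulVf ?gt_eqF// mul1r mulrC ler_pdivrMr//.
  nra.
- move=> m /LX Lm; rewrite divr_ge0 ?mulr_ge0 ?sqr_ge0 ?ler0n//; lra.
- move=> m q /LX Lm; rewrite divr_ge0 ?von_mangoldt_ge0//; lra.
- move=> m /andP[Xm mN]; apply: von_mangoldt_transition_total.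
  by rewrite mN (leq_trans X1).
(* The 6 is the shift 5 plus a loss of [ln 2 <= 1], incurred because [n * Q] below may be as small
   as [X / 2]. *)
set u := L X - 6; have u1 : 1 <= u by rewrite /u; lra.
have u0 : 0 < u by lra.
have w0 : 0 <= u^-1 + 5 / u ^+ 2.
  by rewrite addr_ge0 ?divr_ge0 ?invr_ge0 ?sqr_ge0// ltW.
have step n : (0 < n < X)%N ->
    \sum_(2 <= q < N.+1 | (X <= n * q)%N) nu (n * q)%N * p (n * q)%N q <=
    n%:R^-1 * (u^-1 + 5 / u ^+ 2).
  (* [Q] is the last [q] with [n * q < X]. *)
  move=> /andP[n0 nX]; pose Q := (X.-1 %/ n)%N.
  have XQ q : (X <= n * q)%N = (Q < q)%N.
    by rewrite /Q ltn_divLR// mulnC -[in LHS](prednK X0).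
  have Q0 : (0 < Q)%N by rewrite /Q divn_gt0// -ltnS (prednK X0).
  have [QN|NQ] := leqP Q N; last first.
    rewrite big_nat_cond big_pred0 ?mulr_ge0 ?invr_ge0//.
    move=> q; apply/negP => /andP[/andP[_ qN]]; rewrite XQ => Qq.
    by move: (leq_trans NQ (leq_trans (ltnW Qq) qN)); rewrite ltnn.
  rewrite (eq_bigl _ _ XQ).
  have -> : \sum_(2 <= q < N.+1 | (Q < q)%N) nu (n * q)%N * p (n * q)%N q =
      n%:R^-1 * \sum_(Q.+1 <= q < N.+1) Lambda q / q%:R / (L (n * q) - 5) ^+ 2.
    rewrite mulr_sumr (@big_nat_widenl _ _ _ Q.+1 2)//.
    rewrite [LHS]big_nat_cond [RHS]big_nat_cond; apply: eq_big => q; first by rewrite andTb.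
    by move=> /andP[/andP[q1 _] Qq]; rewrite nupE ?XQ ?(ltnW q1).
  rewrite ler_wpM2l ?invr_ge0//.
  (* [X <= n * (Q + 1) <= 2 * n * Q], since [Q >= 1]. *)
  have XnQ : (X <= 2 * (n * Q))%N.
    rewrite (mulnCA 2 n Q) XQ mul2n -addnn -[Q in (Q < _)%N]addn0 ltn_add2l//.
  have LQ : u <= L (n * Q) - 5.
    have := le_ln_nat R X0 XnQ; rewrite lnM_nat ?muln_gt0 ?n0//.
    by have := ln2_le1 R; rewrite /u; lra.
  apply: le_trans (von_mangoldt_tail n0 _ _) _; rewrite ?Q0//; first by lra.
  set v := L (n * Q) - 5 in LQ *; have v0 : 0 < v by lra.
  rewrite lerD ?lef_pV2 ?posrE// ler_wpM2l// lef_pV2 ?posrE ?exprn_gt0//.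
  by rewrite ler_pXn2r ?nnegrE ?(ltW u0) ?(ltW v0).
rewrite big_nat; apply: le_trans (ler_sum _ step) _.
rewrite -big_nat -mulr_suml.
have harm : \sum_(1 <= n < X) n%:R^-1 <= u + 7.
  have -> : u + 7 = 1 + L X by rewrite /u; lra.
  apply: le_trans (sum_inv_le_ln X0).
  by rewrite big_nat_recr//= lerDl invr_ge0.
apply: le_trans (ler_wpM2r w0 harm) _.
have -> : (u + 7) * (u^-1 + 5 / u ^+ 2) = 1 + 12 / u + 35 / u ^+ 2.
  by field; rewrite gt_eqF.
(* As [u >= 1], both error terms combine into [(12 + 35) / u]. *)
have : 35 / u ^+ 2 <= 35 / u.
  rewrite ler_wpM2l// lef_pV2 ?posrE ?exprn_gt0//.
  by rewrite expr2 ler_peMr// ltW.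
by set a := 35 / u; have -> : 47 / u = 12 / u + a; [rewrite /a; lra | lra].
Qed.

End PrimitiveSums.

(** * Numerical constants *)

Section Constants.
Variable R : realType.
Local Notation L n := (ln (n%:R : R)).

Let H (n : nat) : R := \sum_(0 <= k < n) (k.+1%:R)^-1.

Lemma euler_gamma_ge : 3 / 2 - ln 3 <= euler_gamma R.
Proof.
pose u n := H n - L n.
have uS n : (0 < n)%N -> u n.+1 <= u n.
  move=> n0; rewrite /u /H big_nat_recr//=; move: (ln_succ_sub_ge R n0).
  by set a := n.+1%:R^-1; set b := ln n.+1%:R; lra.
(* [H n - ln (n + 1)] increases to gamma; its value at [n = 2] suffices. *)
have HS n : (2 <= n)%N -> 3 / 2 - ln 3 <= H n - L n.+1.
  elim: n => // n IH; rewrite leq_eqVlt => /orP[/eqP <-|].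
    rewrite /H big_nat_recr//= big_nat1; lra.
  rewrite ltnS => n2; have n1 : (0 < n.+1)%N by [].
  rewrite /H big_nat_recr//=; move: (IH n2) (ln_succ_sub_le R n1).
  by rewrite -/(H n.+1) /H; set a := n.+1%:R^-1; set b := ln n.+2%:R; lra.
have u_ge n : (2 <= n)%N -> 3 / 2 - ln 3 <= u n.
  move=> n2; apply: le_trans (HS _ n2) _; rewrite /u lerB// le_ln_nat//.
  exact: leq_trans n2.
have cu : cvgn u.
  (* The shift skips [u 0], which is 0 because [ln 0 = 0]: monotonicity and the lower bound both
     fail there. *)
  have : cvgn [sequence u (n + 2)%N]_n.
    apply: (@nonincreasing_is_cvgn _ _).
      by apply/nonincreasing_seqP => n /=; rewrite addSn uS// addn2.
    by exists (3 / 2 - ln 3) => _ [n _ <-] /=; rewrite u_ge ?leq_addl.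
  by case/cvg_ex => l; rewrite cvg_shiftn => ul; apply/cvg_ex; exists l.
apply: limr_ge => //; exists 2%N => // n /= n2; exact: u_ge.
Qed.

Lemma sin_le (x : R) : 0 <= x -> sin x <= x.
Proof.
move=> x0; have := @ger0_derive1_ndecry R (fun t => t - sin t) 0.
have dr (t : R) : is_derive t (1 : R) (fun t : R => t - sin t) (1 - cos t).
  exact: is_deriveB.
move=> /(_ _ _ _ 0 x (lexx _) x0) h.
have := h _ _ _; rewrite sin0 subrr subr_ge0; apply.
- by move=> t _; case: (dr t).
- by move=> t _; rewrite derive1E (@derive_val _ _ _ _ _ _ _ (dr t)) subr_ge0 cos_le1.
- by apply: continuous_subspaceT => t; apply: differentiable_continuous; apply/derivable1_diffP; case: (dr t).
Qed.

(** From [cos (pi / 2) = 0], [sin (pi / 4) ^+ 2 = 1 / 2], while [sin (pi / 4) <= pi / 4]. *)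
Lemma pi_sqr_ge8 : 8 <= pi ^+ 2 :> R.
Proof.
have p0 : 0 <= pi / 4 :> R by rewrite divr_ge0 ?pi_ge0.
have s0 : 0 <= sin (pi / 4) :> R.
  by rewrite sin_ge0_pi// p0/=; have := @pi_ge0 R; lra.
have : cos (pi / 2) = 1 - 2 * sin (pi / 4) ^+ 2 :> R.
  have -> : pi / 2 = pi / 4 + pi / 4 :> R by field.
  by rewrite cosD -!expr2 cos2sin2; lra.
rewrite cos_pihalf => h; have := sin_le p0; nra.
Qed.

Lemma pi_ge14_5 : 14 / 5 <= pi :> R.
Proof. by have := pi_sqr_ge8; have := @pi_ge0 R; nra. Qed.

(** Bounds [(1 + 3 / 64) ^ 32] from below by five squarings, the intermediate values being rounded
    down to four decimals. *)
Lemma expR3_2_ge : 43 / 10 <= expR (3 / 2 : R).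
Proof.
have -> : 3 / 2 = 32%:R * (3 / 64) :> R by lra.
rewrite expRM_natl.
have h1 : 67 / 64 <= expR (3 / 64 : R) by have := @expR_ge1Dx R (3 / 64); lra.
have sq (a b c : R) : 0 <= a -> a <= b -> c <= a ^+ 2 -> c <= b ^+ 2.
  by move=> a0 ab /le_trans; apply; rewrite ler_pXn2r// nnegrE (le_trans a0).
have -> : forall x : R, x ^+ 32 = ((((x ^+ 2) ^+ 2) ^+ 2) ^+ 2) ^+ 2.
  by move=> x; rewrite -!exprM.
apply: (sq (20796 / 10000)); [lra| |lra].
apply: (sq (14421 / 10000)); [lra| |lra].
apply: (sq (12009 / 10000)); [lra| |lra].
apply: (sq (10959 / 10000)); [lra| |lra].
by apply: (sq (67 / 64)); [lra| |lra].
Qed.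

(** The bounds just suffice: [(43 / 30) * (7 / 10) = 301 / 300]. *)
Lemma euler_pi_gt1 : 1 < expR (euler_gamma R) * pi / 4.
Proof.
have : expR (3 / 2 - ln 3) <= expR (euler_gamma R).
  by rewrite ler_expR euler_gamma_ge.
rewrite expRB lnK ?posrE// => h.
have := expR3_2_ge; have := pi_ge14_5.
set p := pi; set e := expR (euler_gamma R) in h *; set f := expR (3 / 2) in h *.
nra.
Qed.

End Constants.

(** * The limit *)

Lemma fsum_primitive_le (R : realType) (X : nat) (A : set nat) :
  7 <= ln (X%:R : R) -> primitive A -> (forall a, A a -> (X <= a)%N) ->
  (fsum R A <= (1 + 47 / (ln X%:R - 6))%:E)%E.
Proof.
move=> LX [A1 Aprim] AX; pose P : pred nat := fun a => `[< A a >].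
have -> : A = [set a | P a] by apply/seteqP; split => a /= /asboolP.
have a_ge0 (m : nat) : (0 <= ((m%:R * ln (m%:R : R))^-1)%:E)%E.
  by rewrite lee_fin invr_ge0 mulr_ge0 ?ler0n ?ln_nat_ge0.
rewrite /fsum -nneseries_esum//; apply: lime_le.
  by apply: is_cvg_nneseries.
apply: nearW => n; rewrite sumEFin lee_fin.
(* Truncation at [n] makes the set finite; the bound obtained is independent of [n]. *)
have -> : \sum_(0 <= i < n | P i) (i%:R * ln (i%:R : R))^-1 =
    \sum_(X <= i < n.+1 | P i && (i < n)%N) (i%:R * ln (i%:R : R))^-1.
  rewrite -big_nat_widen// (@big_nat_widenl _ _ _ X 0)//.
  apply: eq_bigl => i; case: (boolP (P i)) => //= /asboolP /AX.
  by move=> ->.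
apply: (@primitive_finite_bound _ X n (fun i => P i && (i < n)%N)) => //.
- by move=> a /andP[/asboolP/AX -> /ltnW].
- by move=> a b /andP[/asboolP Aa _] /andP[/asboolP Ab _]; exact: Aprim.
Qed.

Lemma primsup_nonincreasing (R : realType) :
  {homo @primsup R : x y / x <= y >-> (y <= x)%E}.
Proof.
move=> x y xy; apply: le_ereal_sup => _ [A [Ap Ay] <-]; exists A => //.
by split => // a Aa; apply: le_trans xy _; exact: Ay.
Qed.

Lemma ln_nat_unbounded (R : realType) (M : R) : exists X : nat, M <= ln X%:R.
Proof.
exists (Num.bound (expR M)); rewrite -[leLHS]expRK.
have H : expR M < (Num.bound (expR M))%:R by apply: archi_boundP; exact: expR_ge0.
by rewrite ler_ln ?posrE ?expR_gt0 ?(ltW H)// (lt_trans _ H)// expR_gt0.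
Qed.

Theorem theorem1p5 (R : realType) :
  cvg (primsup (R:=R) x @[x --> +oo%R]) /\
  (lim (primsup (R:=R) x @[x --> +oo%R]) <= (expR (euler_gamma R) * pi / 4)%:E)%E.
Proof.
(* By monotonicity the limit is the infimum over [x], so a single good [X] suffices. *)
have cv := nonincreasing_cvge (@primsup_nonincreasing R).
split; first by apply/cvg_ex; eexists; exact: cv.
rewrite (cvg_lim _ cv)//; set B := _ * pi / 4.
have B1 : 0 < B - 1 by rewrite subr_gt0 euler_pi_gt1.
(* Chosen so that [ln X >= 7] and [47 / (ln X - 6) <= B - 1]. *)
have [X LX] := ln_nat_unbounded (7 + 47 / (B - 1)).
have d0 : 0 < 47 / (B - 1) by rewrite divr_gt0.
apply: le_trans (ereal_inf_lbound _) _; first by exists X%:R.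
apply: ge_ereal_sup => _ [A [Ap AX] <-].
apply: le_trans (fsum_primitive_le (X := X) _ Ap _) _.
- by lra.
- by move=> a /AX; rewrite ler_nat.
rewrite lee_fin -lerBrDl ler_pdivrMr; last by lra.
rewrite mulrC -ler_pdivrMr//; lra.
Qed.
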